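(* There are constants $\delta_0>0$ and $C$ such that the following holds. Let $\beta,a,b$ be real constants, let $$g_0(\varrho)=a\cos\phi,\qquad \phi=\varrho+\delta\ln\varrho+b,\qquad \delta=\tfrac{3}{8}\beta a^2,$$ and assume $0\le\delta\le\delta_0$. Then the ordinary differential equation $$\ddot g+\Big(1+\frac{\beta}{\varrho}g^2+\frac{1}{4\varrho^2}\Big)g=0$$ has a solution $g$ on $\varrho\ge1$ satisfying $$|\dot g-\dot g_0|+|g-g_0|\le C\frac{|a|}{\varrho},\qquad \varrho\ge 1.$$
   Context: Dots denote derivatives with respect to the real variable $\varrho$; all functions are real valued. *)

(* Defs.v *)
From Stdlib Require Import Reals.
From Coquelicot Require Import Coquelicot.
Open Scope R_scope.

Definition ray (x : R) : Prop := 1 <= x.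

(** The derivative is taken relative to [ray], hence it is one-sided at [1]. *)
Definition deriv_on_ray (f df : R -> R) : Prop :=
  forall rho : R, 1 <= rho -> D_in f df ray rho.

(** [g] solves the equation on [1 <= rho], with first derivative [dg]
    (which is uniquely determined there by [g]). *)
Definition ode_solution (beta : R) (g dg : R -> R) : Prop :=
  deriv_on_ray g dg /\
  exists ddg : R -> R,
    deriv_on_ray dg ddg /\
    forall rho : R, 1 <= rho ->
      ddg rho
      + (1 + beta / rho * (g rho) ^ 2 + 1 / (4 * rho ^ 2)) * g rho = 0.

Definition delta (beta a : R) : R := 3 / 8 * beta * a ^ 2.

Definition phase (beta a b rho : R) : R := rho + delta beta a * ln rho + b.

Definition g0 (beta a b rho : R) : R := a * cos (phase beta a b rho).

(* Main.v *)
Require Import Defs.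
From Stdlib Require Import Reals Lra Lia.
From Coquelicot Require Import Coquelicot.
Open Scope R_scope.

(** Substituting [g = a h] leaves an equation that depends on [beta] and [a] only
    through [delta]:
      [h'' + (1 + (8/3) delta h^2 / s + 1 / (4 s^2)) h = 0].
    With [phi = s + delta ln s + b], the resonant part [2 delta cos phi / s] of
    [(8/3) delta (cos phi)^3 / s] is cancelled by the logarithm in [phi]; this is
    what fixes the value of [delta].  The other part,
    [(2/3) delta cos (3 phi) / s], oscillates at a nonresonant frequency and is
    removed by the corrector in
      [u = cos phi + (delta / 12) cos (3 phi) / s],
    since [c cos (3 phi) / s] contributes [- 8 c cos (3 phi) / s] to leading order.
    The residual of [u] is therefore [O(1 / s^2)] ([residual_bound]), which is
    integrable, whereas that of [cos phi] is only [O(1 / s)].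

    For [h = u + w] the equation reads [w'' + w = Phi (s, w)], where
    [Phi (s, 0) = O(1 / s^2)] and [Phi] is Lipschitz in [w] with constant
    [O(delta) / s + 1 / (4 s^2)] ([remainder_lipschitz]).  The solution that decays
    at infinity is the fixed point of
      [w(x) = \int_x^oo sin (s - x) Phi (s, w(s)) ds],
    and in the norm [sup s |w(s)|] over [s >= 1] this map is a contraction of a ball
    once [delta] is small: a difference of size [D / s] gives an integrand of size
    [L D / s^2], whose tail is again [O(L D / x)] ([osc_forcing_contraction]).
    Here [1 / (4 s^2)] is not small at [s = 1], but its coefficient [1 / 4] is small
    enough.  The fixed point and its derivative are both [O(1 / s)]
    ([perturbed_oscillator]), and so is the corrector, which gives the estimate. *)

(** * Integrals to infinity of quadratically decaying functions *)

(** The improper integral of [f] over [[x, +oo)].  Only absolutely convergent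
    integrals occur, so integer endpoints determine the limit. *)
Definition tail (f : R -> R) (x : R) : R :=
  real (Lim_seq (fun n => RInt f x (INR n))).

Definition quad_decay (K : R) (f : R -> R) : Prop :=
  forall s, 1 <= s -> Rabs (f s) <= K / s ^ 2.

Lemma ex_derive_continuousR (f : R -> R) (x : R) : ex_derive f x -> continuous f x.
Proof. exact (ex_derive_continuous f x). Qed.

Lemma ex_RInt_everywhere (f : R -> R) (x y : R) :
  (forall s, continuous f s) -> ex_RInt f x y.
Proof. intros Hf; apply (ex_RInt_continuous (V := R_CompleteNormedModule)); auto. Qed.

Lemma RInt_add (f : R -> R) (x y z : R) :
  (forall s, continuous f s) -> RInt f x y + RInt f y z = RInt f x z.
Proof.
  intros Hf; apply (RInt_Chasles (V := R_CompleteNormedModule));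
    now apply ex_RInt_everywhere.
Qed.

Lemma is_RInt_inv_sq (K x y : R) :
  0 < x -> x <= y -> is_RInt (fun s => K / s ^ 2) x y (K / x - K / y).
Proof.
  intros Hx Hxy.
  replace (K / x - K / y) with (minus (- K / y) (- K / x))
    by (unfold minus, plus, opp; simpl; field; lra).
  apply (is_RInt_derive (fun s => - K / s)).
  - intros s [Hs _]; rewrite Rmin_left in Hs by lra.
    auto_derive; [lra | field; lra].
  - intros s [Hs _]; rewrite Rmin_left in Hs by lra.
    apply ex_derive_continuousR; auto_derive; nra.
Qed.

Lemma RInt_quad_decay (K : R) (f : R -> R) (x y : R) :
  (forall s, continuous f s) -> quad_decay K f -> 1 <= x -> x <= y ->
  Rabs (RInt f x y) <= K / x - K / y.
Proof.
  intros Hf HK Hx Hxy.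
  apply (norm_RInt_le f (fun s => K / s ^ 2) x y); try lra.
  - intros s Hs; apply HK; lra.
  - apply (RInt_correct (V := R_CompleteNormedModule)), ex_RInt_everywhere, Hf.
  - apply is_RInt_inv_sq; lra.
Qed.

Lemma quad_decay_const_ge0 (K : R) (f : R -> R) : quad_decay K f -> 0 <= K.
Proof.
  intros HK; generalize (HK 1 (Rle_refl 1)) (Rabs_pos (f 1)); lra.
Qed.

(** Beyond [N] the partial integrals differ by at most [K / N], so they form a
    Cauchy sequence. *)
Lemma tail_cvg (K : R) (f : R -> R) (x : R) :
  (forall s, continuous f s) -> quad_decay K f ->
  is_lim_seq (fun n => RInt f x (INR n)) (tail f x).
Proof.
  intros Hf HK.
  apply Lim_seq_correct', ex_lim_seq_cauchy_corr.
  assert (K0 := quad_decay_const_ge0 K f HK).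
  (* it suffices to compare with an index beyond [K / eps] *)
  assert (Hmain : forall (eps : posreal) (N n m : nat), 1 <= INR N -> K / INR N < eps ->
    (N <= n)%nat -> (n <= m)%nat ->
    Rabs (RInt f x (INR n) - RInt f x (INR m)) < eps).
  { intros eps N n m HN Heps Hn Hm.
    apply le_INR in Hn; apply le_INR in Hm.
    rewrite Rabs_minus_sym.
    rewrite <- (RInt_add f x (INR n) (INR m) Hf).
    rewrite Rplus_minus_l.
    apply Rle_lt_trans with (1 := RInt_quad_decay K f (INR n) (INR m) Hf HK ltac:(lra) Hm).
    apply Rle_lt_trans with (2 := Heps).
    assert (0 <= K / INR m) by (apply Rdiv_le_0_compat; lra).
    assert (K / INR n <= K / INR N); [| lra].
    apply Rmult_le_compat_l; [lra |]; apply Rinv_le_contravar; lra. }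
  intros eps.
  destruct (archimed_cor1 (eps / (K + 1))) as [N [HN HN0]].
  { apply Rdiv_lt_0_compat; [apply cond_pos | lra]. }
  assert (H1 : 1 <= INR N) by (apply (le_INR 1); lia).
  assert (Heps : K / INR N < eps).
  { apply Rmult_lt_compat_r with (r := K + 1) in HN; [| lra].
    replace (eps / (K + 1) * (K + 1)) with (pos eps) in HN by (field; lra).
    assert (0 < / INR N) by (apply Rinv_0_lt_compat; lra).
    unfold Rdiv; nra. }
  exists N; intros n m Hn Hm.
  destruct (Nat.le_ge_cases n m) as [H | H].
  - now apply (Hmain eps N).
  - rewrite Rabs_minus_sym; now apply (Hmain eps N).
Qed.

Lemma tail_Chasles (K : R) (f : R -> R) (x y : R) :
  (forall s, continuous f s) -> quad_decay K f ->
  tail f x = RInt f x y + tail f y.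
Proof.
  intros Hf HK.
  assert (H : is_lim_seq (fun n => RInt f x (INR n)) (RInt f x y + tail f y)).
  { apply is_lim_seq_ext with (fun n => RInt f x y + RInt f y (INR n)).
    - intros n; now apply RInt_add.
    - apply is_lim_seq_plus'; [apply is_lim_seq_const | now apply tail_cvg with K]. }
  apply is_lim_seq_unique in H; unfold tail at 1; now rewrite H.
Qed.

(** A tail is a constant plus an integral with [x] as its lower endpoint, whence the
    minus sign. *)
Lemma is_derive_tail (K : R) (f : R -> R) (x : R) :
  (forall s, continuous f s) -> quad_decay K f -> is_derive (tail f) x (- f x).
Proof.
  intros Hf HK.
  apply is_derive_ext with (fun y => RInt f y x + tail f x).
  - intros y; symmetry; now apply tail_Chasles with K.
  - replace (- f x) with (plus (opp (f x)) 0) by (unfold plus, opp; simpl; ring).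
    apply (is_derive_plus (K := R_AbsRing) (V := R_NormedModule));
      [| exact (is_derive_const (tail f x) x)].
    apply (is_derive_RInt' (V := R_CompleteNormedModule) f (fun y => RInt f y x) x x); [| apply Hf].
    exists (mkposreal 1 Rlt_0_1); intros y _.
    apply (RInt_correct (V := R_CompleteNormedModule)), ex_RInt_everywhere, Hf.
Qed.

Lemma tail_bound (K : R) (f : R -> R) (x : R) :
  (forall s, continuous f s) -> quad_decay K f -> 1 <= x -> Rabs (tail f x) <= K / x.
Proof.
  intros Hf HK Hx.
  assert (K0 := quad_decay_const_ge0 K f HK).
  assert (H := is_lim_seq_abs _ _ (tail_cvg K f x Hf HK)).
  destruct (INR_unbounded x) as [N HN].
  refine (is_lim_seq_le_loc _ (fun _ => K / x) _ _ _ H (is_lim_seq_const (K / x))).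
  exists N; intros n Hn; apply le_INR in Hn.
  apply Rle_trans with (1 := RInt_quad_decay K f x (INR n) Hf HK Hx ltac:(lra)).
  assert (0 <= K / INR n) by (apply Rdiv_le_0_compat; lra); lra.
Qed.

Lemma tail_minus (K K' : R) (f f' : R -> R) (x : R) :
  (forall s, continuous f s) -> quad_decay K f ->
  (forall s, continuous f' s) -> quad_decay K' f' ->
  tail (fun s => f s - f' s) x = tail f x - tail f' x.
Proof.
  intros Hf HK Hf' HK'.
  assert (H : is_lim_seq (fun n => RInt (fun s => f s - f' s) x (INR n))
                (tail f x - tail f' x)).
  { apply is_lim_seq_ext with (fun n => RInt f x (INR n) - RInt f' x (INR n)).
    - intros n; symmetry.
      apply (RInt_minus (V := R_CompleteNormedModule)); now apply ex_RInt_everywhere.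
    - apply is_lim_seq_minus'; [now apply tail_cvg with K | now apply tail_cvg with K']. }
  apply is_lim_seq_unique in H; unfold tail at 1; now rewrite H.
Qed.

(** * The decaying solution of the forced oscillator *)

(** Expansion of [\int_x^oo sin (s - x) f(s) ds]: variation of parameters for
    [w'' + w = f] with zero data at infinity.  Splitting the kernel keeps [x] out of
    the integrands, so that differentiation only needs [is_derive_tail]. *)
Definition osc (f : R -> R) (x : R) : R :=
  cos x * tail (fun s => sin s * f s) x - sin x * tail (fun s => cos s * f s) x.

(** Expansion of [- \int_x^oo cos (s - x) f(s) ds], the derivative of [osc f]. *)
Definition dosc (f : R -> R) (x : R) : R :=
  - sin x * tail (fun s => sin s * f s) x - cos x * tail (fun s => cos s * f s) x.

Lemma Rabs_sin_le1 (x : R) : Rabs (sin x) <= 1.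
Proof. apply Rabs_le; generalize (SIN_bound x); lra. Qed.

Lemma Rabs_cos_le1 (x : R) : Rabs (cos x) <= 1.
Proof. apply Rabs_le; generalize (COS_bound x); lra. Qed.

Lemma Rabs_mult_bound (x y A B : R) :
  Rabs x <= A -> Rabs y <= B -> Rabs (x * y) <= A * B.
Proof.
  intros HA HB; rewrite Rabs_mult; apply Rmult_le_compat; auto using Rabs_pos.
Qed.

Lemma Rabs_plus_bound (x y A B : R) :
  Rabs x <= A -> Rabs y <= B -> Rabs (x + y) <= A + B.
Proof. intros HA HB; generalize (Rabs_triang x y); lra. Qed.

Lemma Rabs_minus_bound (x y A B : R) :
  Rabs x <= A -> Rabs y <= B -> Rabs (x - y) <= A + B.
Proof.
  intros HA HB; apply Rabs_plus_bound; [| rewrite Rabs_Ropp]; assumption.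
Qed.

Lemma quad_decay_mult (K : R) (c f : R -> R) :
  (forall s, Rabs (c s) <= 1) -> quad_decay K f -> quad_decay K (fun s => c s * f s).
Proof.
  intros Hc HK s Hs.
  replace (K / s ^ 2) with (1 * (K / s ^ 2)) by ring.
  apply Rabs_mult_bound; auto.
Qed.

Section Oscillator.

Variables (K : R) (f : R -> R).
Hypotheses (Hf : forall s, continuous f s) (HK : quad_decay K f).

Let cont_sin : forall s, continuous (fun s => sin s * f s) s.
Proof.
  intros s; apply (continuous_mult (K := R_AbsRing)); auto.
  apply ex_derive_continuousR; auto_derive; auto.
Qed.

Let cont_cos : forall s, continuous (fun s => cos s * f s) s.
Proof.
  intros s; apply (continuous_mult (K := R_AbsRing)); auto.
  apply ex_derive_continuousR; auto_derive; auto.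
Qed.

Let dec_sin : quad_decay K (fun s => sin s * f s).
Proof. apply quad_decay_mult; [apply Rabs_sin_le1 | exact HK]. Qed.

Let dec_cos : quad_decay K (fun s => cos s * f s).
Proof. apply quad_decay_mult; [apply Rabs_cos_le1 | exact HK]. Qed.

Lemma is_derive_osc (x : R) : is_derive (osc f) x (dosc f x).
Proof.
  assert (HA := is_derive_tail K _ x cont_sin dec_sin).
  assert (HB := is_derive_tail K _ x cont_cos dec_cos).
  unfold osc, dosc.
  set (A := tail (fun s => sin s * f s)) in *.
  set (B := tail (fun s => cos s * f s)) in *.
  auto_derive.
  - repeat split; eexists; eassumption.
  - replace (Derive (fun y => A y) x) with (- (sin x * f x))
      by (symmetry; apply is_derive_unique; exact HA).
    replace (Derive (fun y => B y) x) with (- (cos x * f x))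
      by (symmetry; apply is_derive_unique; exact HB).
    ring.
Qed.

(** The boundary terms of the two tails add up to
    [(sin^2 x + cos^2 x) f(x) = f(x)]. *)
Lemma is_derive_dosc (x : R) : is_derive (dosc f) x (f x - osc f x).
Proof.
  assert (HA := is_derive_tail K _ x cont_sin dec_sin).
  assert (HB := is_derive_tail K _ x cont_cos dec_cos).
  unfold osc, dosc.
  set (A := tail (fun s => sin s * f s)) in *.
  set (B := tail (fun s => cos s * f s)) in *.
  auto_derive.
  - repeat split; eexists; eassumption.
  - replace (Derive (fun y => A y) x) with (- (sin x * f x))
      by (symmetry; apply is_derive_unique; exact HA).
    replace (Derive (fun y => B y) x) with (- (cos x * f x))
      by (symmetry; apply is_derive_unique; exact HB).
    assert (H := sin2_cos2 x); unfold Rsqr in H.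
    (* a unit factor makes the identity polynomial in [sin x] and [cos x] *)
    replace (f x) with (f x * (sin x * sin x + cos x * cos x)) at 3
      by (rewrite H; ring).
    ring.
Qed.

(** The factor [2] comes from bounding the two terms of the split kernel separately;
    it is why [perturbed_oscillator] asks for [2 * L < 1]. *)
Lemma osc_bound (x : R) : 1 <= x -> Rabs (osc f x) <= 2 * K / x.
Proof.
  intros Hx; replace (2 * K / x) with (1 * (K / x) + 1 * (K / x)) by (field; lra).
  apply Rabs_minus_bound; apply Rabs_mult_bound;
    auto using Rabs_cos_le1, Rabs_sin_le1, tail_bound.
Qed.

Lemma dosc_bound (x : R) : 1 <= x -> Rabs (dosc f x) <= 2 * K / x.
Proof.
  intros Hx; replace (2 * K / x) with (1 * (K / x) + 1 * (K / x)) by (field; lra).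
  apply Rabs_minus_bound; apply Rabs_mult_bound;
    try rewrite Rabs_Ropp; auto using Rabs_cos_le1, Rabs_sin_le1, tail_bound.
Qed.

Lemma osc_minus (K' : R) (f' : R -> R) (x : R) :
  (forall s, continuous f' s) -> quad_decay K' f' ->
  osc (fun s => f s - f' s) x = osc f x - osc f' x.
Proof.
  intros Hf' HK'; unfold osc.
  assert (Hsin : tail (fun s => sin s * (f s - f' s)) x
                 = tail (fun s => sin s * f s) x - tail (fun s => sin s * f' s) x).
  { rewrite <- (tail_minus K K'); trivial.
    - unfold tail; f_equal; apply Lim_seq_ext; intros n.
      apply RInt_ext; intros; apply Rmult_minus_distr_l.
    - intros s; apply (continuous_mult (K := R_AbsRing)); auto.
      apply ex_derive_continuousR; auto_derive; auto.
    - apply quad_decay_mult; [apply Rabs_sin_le1 | exact HK']. }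
  assert (Hcos : tail (fun s => cos s * (f s - f' s)) x
                 = tail (fun s => cos s * f s) x - tail (fun s => cos s * f' s) x).
  { rewrite <- (tail_minus K K'); trivial.
    - unfold tail; f_equal; apply Lim_seq_ext; intros n.
      apply RInt_ext; intros; apply Rmult_minus_distr_l.
    - intros s; apply (continuous_mult (K := R_AbsRing)); auto.
      apply ex_derive_continuousR; auto_derive; auto.
    - apply quad_decay_mult; [apply Rabs_cos_le1 | exact HK']. }
  rewrite Hsin, Hcos; ring.
Qed.

End Oscillator.

(** * Picard iteration with weight [1 / s] *)

(** Summing the geometric series of increments gives both the limit and the distance
    to it. *)
Lemma geometric_cvg (x : nat -> R) (D q : R) :
  0 <= q < 1 -> (forall n, Rabs (x (S n) - x n) <= D * q ^ n) ->
  is_lim_seq x (real (Lim_seq x)) /\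
  forall n, Rabs (real (Lim_seq x) - x n) <= D / (1 - q) * q ^ n.
Proof.
  intros Hq Hx.
  assert (HD : 0 <= D).
  { generalize (Hx 0%nat) (Rabs_pos (x 1%nat - x 0%nat)); simpl; lra. }
  assert (Hk : forall n k, Rabs (x (n + k)%nat - x n)
                           <= D / (1 - q) * q ^ n * (1 - q ^ k)).
  { intros n; induction k as [| k IH].
    - rewrite Nat.add_0_r, Rminus_diag, Rabs_R0; simpl; lra.
    - replace (x (n + S k)%nat - x n)
        with ((x (S (n + k)) - x (n + k)%nat) + (x (n + k)%nat - x n))
        by (rewrite Nat.add_succ_r; ring).
      replace (D / (1 - q) * q ^ n * (1 - q ^ S k))
        with (D * q ^ (n + k) + D / (1 - q) * q ^ n * (1 - q ^ k))
        by (rewrite pow_add; simpl; field; lra).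
      apply Rabs_plus_bound; auto. }
  assert (Hle : forall n k, Rabs (x (n + k)%nat - x n) <= D / (1 - q) * q ^ n).
  { intros n k; apply Rle_trans with (1 := Hk n k).
    assert (0 <= D / (1 - q) * q ^ n).
    { apply Rmult_le_pos; [apply Rdiv_le_0_compat; lra | apply pow_le; lra]. }
    assert (0 <= q ^ k) by (apply pow_le; lra); nra. }
  assert (Hlim : is_lim_seq x (real (Lim_seq x))).
  { apply Lim_seq_correct', ex_lim_seq_cauchy_corr; intros eps.
    destruct (pow_lt_1_zero q) with (y := eps / 2 / (D / (1 - q) + 1)) as [N HN].
    - rewrite Rabs_pos_eq; lra.
    - apply Rdiv_lt_0_compat; [apply is_pos_div_2 |].
      assert (0 <= D / (1 - q)) by (apply Rdiv_le_0_compat; lra); lra.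
    - exists N; intros n m Hn Hm.
      assert (Hd : D / (1 - q) * q ^ N < eps / 2).
      { specialize (HN N (Nat.le_refl N)).
        assert (0 <= D / (1 - q)) by (apply Rdiv_le_0_compat; lra).
        assert (0 <= q ^ N) by (apply pow_le; lra).
        rewrite Rabs_pos_eq in HN by assumption.
        apply Rmult_lt_compat_r with (r := D / (1 - q) + 1) in HN; [| lra].
        replace (eps / 2 / (D / (1 - q) + 1) * (D / (1 - q) + 1))
          with (eps / 2) in HN by (field; lra).
        nra. }
      assert (Hn' := Hle N (n - N)%nat); assert (Hm' := Hle N (m - N)%nat).
      replace (N + (n - N))%nat with n in Hn' by lia.
      replace (N + (m - N))%nat with m in Hm' by lia.
      replace (x n - x m) with ((x n - x N) - (x m - x N)) by ring.
      assert (H := Rabs_minus_bound _ _ _ _ Hn' Hm'); lra. }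
  split; [exact Hlim |]; intros n.
  apply (is_lim_seq_le (fun k => Rabs (x (k + n)%nat - x n)) (fun _ => D / (1 - q) * q ^ n)
           (Rabs (real (Lim_seq x) - x n)) (D / (1 - q) * q ^ n)).
  - intros k; rewrite Nat.add_comm; apply Hle.
  - apply (is_lim_seq_abs _ (real (Lim_seq x) - x n)), is_lim_seq_minus';
      [| apply is_lim_seq_const].
    now apply (is_lim_seq_incr_n x n).
  - apply is_lim_seq_const.
Qed.

(** Forcings are read through [clip], so that they are defined and continuous on all
    of [R] although the hypotheses on them only concern [1 <= s]; the integrals then
    need no side conditions on their endpoints. *)
Definition clip (s : R) : R := Rmax 1 s.

Lemma clip_ge1 (s : R) : 1 <= clip s.
Proof. apply Rmax_l. Qed.

Lemma clip_id (s : R) : 1 <= s -> clip s = s.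
Proof. apply Rmax_right. Qed.

Lemma continuous_clip (s : R) : continuous clip s.
Proof.
  apply continuous_ext with (fun s => (1 + s + Rabs (s - 1)) / 2).
  - intros t; unfold clip, Rmax, Rabs.
    destruct (Rle_dec 1 t), (Rcase_abs (t - 1)); lra.
  - apply (continuous_mult (K := R_AbsRing)); [| apply continuous_const].
    apply (continuous_plus (V := R_NormedModule)).
    + apply ex_derive_continuousR; auto_derive; auto.
    + apply continuous_Rabs_comp, ex_derive_continuousR; auto_derive; auto.
Qed.

Section Picard.

Variables (Phi : R -> R -> R) (K0 L r : R).
Hypothesis Phi_cont : forall v s,
  1 <= s -> continuous v s -> continuous (fun t => Phi t (v t)) s.
Hypothesis Phi_0 : forall s, 1 <= s -> Rabs (Phi s 0) <= K0 / s ^ 2.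
Hypothesis Phi_lip : forall s w w',
  1 <= s -> Rabs w <= r / s -> Rabs w' <= r / s ->
  Rabs (Phi s w - Phi s w') <= L / s * Rabs (w - w').
Hypotheses (L_ge0 : 0 <= L) (L_lt : 2 * L < 1) (r_ge : 2 * (K0 + L * r) <= r).

Definition admissible (v : R -> R) : Prop :=
  (forall s, continuous v s) /\ forall s, 1 <= s -> Rabs (v s) <= r / s.

Definition forcing (v : R -> R) (s : R) : R := Phi (clip s) (v (clip s)).

Let r_ge0 : 0 <= r.
Proof.
  assert (H := Phi_0 1 (Rle_refl 1)).
  assert (H' := Rabs_pos (Phi 1 0)); nra.
Qed.

Lemma admissible_0 : admissible (fun _ => 0).
Proof.
  split.
  - intros s; apply continuous_const.
  - intros s Hs; rewrite Rabs_R0; apply Rdiv_le_0_compat; lra.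
Qed.

Lemma continuous_forcing (v : R -> R) (s : R) :
  (forall t, continuous v t) -> continuous (forcing v) s.
Proof.
  intros Hv.
  apply (continuous_comp clip (fun t => Phi t (v t))); [apply continuous_clip |].
  apply Phi_cont; [apply clip_ge1 | apply Hv].
Qed.

Lemma forcing_decay (v : R -> R) : admissible v -> quad_decay (K0 + L * r) (forcing v).
Proof.
  intros [_ Hv] s Hs; unfold forcing; rewrite clip_id by exact Hs.
  replace (Phi s (v s)) with (Phi s 0 + (Phi s (v s) - Phi s 0)) by ring.
  replace ((K0 + L * r) / s ^ 2) with (K0 / s ^ 2 + L / s * (r / s)) by (field; lra).
  apply Rabs_plus_bound; [now apply Phi_0 |].
  apply Rle_trans with (L / s * Rabs (v s - 0)).
  - apply Phi_lip; auto; apply admissible_0; exact Hs.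
  - rewrite Rminus_0_r; apply Rmult_le_compat_l; auto; apply Rdiv_le_0_compat; lra.
Qed.

Lemma osc_forcing_admissible (v : R -> R) : admissible v -> admissible (osc (forcing v)).
Proof.
  intros Hv; split.
  - intros s; apply ex_derive_continuousR; eexists.
    apply is_derive_osc with (K0 + L * r); [| now apply forcing_decay].
    intros; apply continuous_forcing, Hv.
  - intros s Hs; apply Rle_trans with (2 * (K0 + L * r) / s).
    + apply osc_bound; trivial; [| now apply forcing_decay].
      intros; apply continuous_forcing, Hv.
    + apply Rmult_le_compat_r; [apply Rlt_le, Rinv_0_lt_compat; lra | lra].
Qed.

(** A difference of size [D / t] is multiplied by the Lipschitz constant [L / t], and
    the resulting [L * D / t ^ 2] integrates back to the weight [1 / s]: this is why
    the coefficient [1 / t], although not integrable, leads to a contraction. *)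
Lemma osc_forcing_contraction (D : R) (v v' : R -> R) (s : R) :
  admissible v -> admissible v' ->
  (forall t, 1 <= t -> Rabs (v t - v' t) <= D / t) -> 1 <= s ->
  Rabs (osc (forcing v) s - osc (forcing v') s) <= 2 * L * D / s.
Proof.
  intros Hv Hv' Hd Hs.
  rewrite <- (osc_minus (K0 + L * r)) with (K' := K0 + L * r);
    try (intros; apply continuous_forcing; first [apply Hv | apply Hv']);
    try (now apply forcing_decay).
  rewrite Rmult_assoc; apply osc_bound; trivial.
  - intros t; apply (continuous_minus (V := R_NormedModule));
      apply continuous_forcing; [apply Hv | apply Hv'].
  - intros t Ht; unfold forcing; rewrite clip_id by exact Ht.
    replace (L * D / t ^ 2) with (L / t * (D / t)) by (field; lra).
    apply Rle_trans with (L / t * Rabs (v t - v' t)).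
    + apply Phi_lip; trivial; [apply Hv | apply Hv']; exact Ht.
    + apply Rmult_le_compat_l; auto; apply Rdiv_le_0_compat; lra.
Qed.

Fixpoint picard (n : nat) : R -> R :=
  match n with
  | O => fun _ => 0
  | S n => osc (forcing (picard n))
  end.

Lemma picard_admissible (n : nat) : admissible (picard n).
Proof.
  induction n; [apply admissible_0 | now apply osc_forcing_admissible].
Qed.

Lemma picard_step (n : nat) (s : R) :
  1 <= s -> Rabs (picard (S n) s - picard n s) <= r * (2 * L) ^ n / s.
Proof.
  revert s; induction n as [| n IH]; intros s Hs.
  - replace (picard 1 s - picard 0 s) with (picard 1 s) by (simpl; ring).
    replace (r * (2 * L) ^ 0 / s) with (r / s) by (simpl; field; lra).
    now apply picard_admissible.
  - replace (r * (2 * L) ^ S n / s) with (2 * L * (r * (2 * L) ^ n) / s)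
      by (simpl; field; lra).
    exact (osc_forcing_contraction _ _ _ s (picard_admissible (S n)) (picard_admissible n)
             IH Hs).
Qed.

Definition picard_lim (s : R) : R := real (Lim_seq (fun n => picard n (clip s))).

Lemma picard_lim_spec (s : R) :
  is_lim_seq (fun n => picard n (clip s)) (picard_lim s) /\
  forall n, Rabs (picard_lim s - picard n (clip s))
            <= r / (1 - 2 * L) * (2 * L) ^ n / clip s.
Proof.
  assert (Hc := clip_ge1 s).
  destruct (geometric_cvg (fun n => picard n (clip s)) (r / clip s) (2 * L))
    as [Hlim Herr].
  - lra.
  - intros n.
    replace (r / clip s * (2 * L) ^ n) with (r * (2 * L) ^ n / clip s) by (field; lra).
    now apply picard_step.
  - split; [exact Hlim |]; intros n.
    replace (r / (1 - 2 * L) * (2 * L) ^ n / clip s)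
      with (r / clip s / (1 - 2 * L) * (2 * L) ^ n) by (field; lra).
    apply Herr.
Qed.

(** On clipped arguments the weight is at most [1], so the convergence is uniform on
    [R] and the limit is continuous. *)
Lemma picard_lim_admissible : admissible picard_lim.
Proof.
  set (M := r / (1 - 2 * L)).
  assert (M0 : 0 <= M) by (apply Rdiv_le_0_compat; lra).
  split.
  - intros s; apply continuity_pt_filterlim.
    apply (CVU_continuity (fun n t => picard n (clip t)) picard_lim s
             (mkposreal 1 Rlt_0_1)).
    + intros eps Heps.
      (* [M + 1] instead of [M], since [M] may vanish *)
      destruct (pow_lt_1_zero (2 * L)) with (y := eps / (M + 1)) as [N HN].
      * rewrite Rabs_pos_eq; lra.
      * apply Rdiv_lt_0_compat; lra.
      * exists N; intros n y Hn _.
        apply Rle_lt_trans with (1 := proj2 (picard_lim_spec y) n).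
        specialize (HN n Hn); fold M.
        assert (Hp : 0 <= (2 * L) ^ n) by (apply pow_le; lra).
        rewrite Rabs_pos_eq in HN by assumption.
        apply Rmult_lt_compat_r with (r := M + 1) in HN; [| lra].
        replace (eps / (M + 1) * (M + 1)) with eps in HN by (field; lra).
        assert (Hc := clip_ge1 y).
        assert (Hi : / clip y <= 1)
          by (rewrite <- Rinv_1; apply Rinv_le_contravar; lra).
        assert (0 < / clip y) by (apply Rinv_0_lt_compat; lra).
        unfold Rdiv.
        assert (0 <= M * (2 * L) ^ n) by (apply Rmult_le_pos; lra).
        nra.
    + intros n y _; apply continuity_pt_filterlim.
      apply (continuous_comp clip (picard n)); [apply continuous_clip |].
      apply picard_admissible.
    + unfold Boule; simpl; rewrite Rminus_diag, Rabs_R0; lra.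
  - intros s Hs.
    assert (H := is_lim_seq_abs _ _ (proj1 (picard_lim_spec s))).
    refine (is_lim_seq_le _ (fun _ => r / s) _ _ _ H (is_lim_seq_const (r / s))).
    intros n; rewrite clip_id by exact Hs; now apply picard_admissible.
Qed.

(** The iterates tend to [picard_lim] by definition, and to [osc (forcing picard_lim)]
    because the map is a contraction. *)
Lemma picard_lim_fixed (s : R) : 1 <= s -> osc (forcing picard_lim) s = picard_lim s.
Proof.
  intros Hs.
  set (M := r / (1 - 2 * L)).
  assert (Hfar : is_lim_seq (fun n => picard (S n) s) (osc (forcing picard_lim) s)).
  { apply is_lim_seq_ext with
      (fun n => osc (forcing picard_lim) s
                + (picard (S n) s - osc (forcing picard_lim) s)); [intros; ring |].
    replace (Finite (osc (forcing picard_lim) s))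
      with (Finite (osc (forcing picard_lim) s + 0)) by (f_equal; ring).
    apply is_lim_seq_plus'; [apply is_lim_seq_const |].
    apply is_lim_seq_abs_0.
    apply is_lim_seq_le_le with (fun _ => 0) (fun n => (2 * L * M / s) * (2 * L) ^ n).
    - intros n; split; [apply Rabs_pos |].
      replace (2 * L * M / s * (2 * L) ^ n) with (2 * L * (M * (2 * L) ^ n) / s)
        by (field; lra).
      rewrite Rabs_minus_sym.
      apply osc_forcing_contraction; trivial;
        [apply picard_lim_admissible | apply picard_admissible |].
      intros t Ht.
      assert (H := proj2 (picard_lim_spec t) n); rewrite clip_id in H; trivial.
    - apply is_lim_seq_const.
    - replace (Finite 0) with (Finite (2 * L * M / s * 0)) by (f_equal; ring).
      apply is_lim_seq_mult'; [apply is_lim_seq_const |].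
      apply is_lim_seq_geom; rewrite Rabs_pos_eq; lra. }
  assert (Hnear := proj1 (picard_lim_spec s)).
  rewrite clip_id in Hnear by exact Hs.
  apply is_lim_seq_incr_1 in Hnear.
  apply is_lim_seq_unique in Hfar; apply is_lim_seq_unique in Hnear.
  rewrite Hfar in Hnear; now injection Hnear.
Qed.

(** A solution of [w'' + w = Phi (s, w)] of size [1 / s], under smallness conditions
    which say that the ball [Rabs (w s) <= r / s] is mapped to itself
    ([2 * (K0 + L * r) <= r]) and that the map contracts it ([2 * L < 1]). *)
Theorem perturbed_oscillator : exists w dw : R -> R,
  forall s, 1 <= s ->
    is_derive w s (dw s) /\ is_derive dw s (Phi s (w s) - w s) /\
    Rabs (w s) <= r / s /\ Rabs (dw s) <= r / s.
Proof.
  set (F := forcing picard_lim).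
  assert (Fc : forall s, continuous F s).
  { intros; apply continuous_forcing, picard_lim_admissible. }
  assert (Fd : quad_decay (K0 + L * r) F).
  { apply forcing_decay, picard_lim_admissible. }
  exists (osc F), (dosc F); intros s Hs; split; [| split; [| split]].
  - now apply is_derive_osc with (K0 + L * r).
  - replace (Phi s (osc F s)) with (F s).
    + exact (is_derive_dosc (K0 + L * r) F Fc Fd s).
    + unfold F at 2; rewrite picard_lim_fixed by exact Hs.
      unfold F, forcing; now rewrite clip_id.
  - apply (osc_forcing_admissible picard_lim picard_lim_admissible); exact Hs.
  - apply Rle_trans with (2 * (K0 + L * r) / s).
    + now apply dosc_bound.
    + apply Rmult_le_compat_r; [apply Rlt_le, Rinv_0_lt_compat; lra | lra].
Qed.

End Picard.

(** * The approximate solution and its residual *)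

Lemma cos_triple (x : R) : cos (3 * x) = 4 * cos x * cos x * cos x - 3 * cos x.
Proof.
  replace (3 * x) with (2 * x + x) by ring.
  rewrite cos_plus, cos_2a_cos, sin_2a.
  assert (H := sin2_cos2 x); unfold Rsqr in H.
  replace (2 * sin x * cos x * sin x) with (2 * cos x * (sin x * sin x)) by ring.
  replace (sin x * sin x) with (1 - cos x * cos x) by lra; ring.
Qed.

(** Here [d] stands for [delta beta a], the only parameter besides the phase shift [b]
    that remains after division of the unknown by [a]. *)
Section Approximation.

Variables d b : R.

Definition ph (s : R) : R := s + d * ln s + b.

Definition dph (s : R) : R := 1 + d / s.

(** The coefficient [d / 12] solves [(1 - 9) c + (2/3) d = 0]: the operator
    [w'' + w] multiplies [cos (3 * ph s)] by [1 - 9] to leading order, and [2/3 * d]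
    is the coefficient of [cos (3 * ph s) / s] in [8/3 * d * cos (ph s) ^ 3 / s]. *)
Definition approx (s : R) : R := cos (ph s) + d / 12 * (cos (3 * ph s) / s).

Definition dapprox (s : R) : R :=
  - dph s * sin (ph s)
  + d / 12 * (- (cos (3 * ph s) / s ^ 2) - 3 * dph s * sin (3 * ph s) / s).

Definition ddapprox (s : R) : R :=
  - dph s ^ 2 * cos (ph s) + d / s ^ 2 * sin (ph s)
  + d / 12 * (2 * cos (3 * ph s) / s ^ 3
              + (6 / s ^ 2 + 9 * d / s ^ 3) * sin (3 * ph s)
              - 9 * dph s ^ 2 * cos (3 * ph s) / s).

Lemma is_derive_approx (s : R) : 1 <= s -> is_derive approx s (dapprox s).
Proof.
  intros Hs; unfold approx, dapprox, dph, ph; auto_derive.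
  - repeat split; lra.
  - field; lra.
Qed.

Lemma is_derive_dapprox (s : R) : 1 <= s -> is_derive dapprox s (ddapprox s).
Proof.
  intros Hs; unfold ddapprox, dapprox, dph, ph; auto_derive.
  - repeat split; try lra; nra.
  - field; lra.
Qed.

(** The forcing of the correction: [h = approx + w] solves the rescaled equation
    exactly when [w'' + w = remainder s w].  At [w = 0] it is minus the residual of
    [approx]. *)
Definition remainder (s w : R) : R :=
  - (8 / 3 * d / s * (approx s + w) ^ 3 + (approx s + w) / (4 * s ^ 2)
     + (ddapprox s + approx s)).

Lemma continuous_remainder (v : R -> R) (s : R) :
  1 <= s -> continuous v s -> continuous (fun t => remainder t (v t)) s.
Proof.
  intros Hs Hv.
  assert (Hu : continuous approx s).
  { apply ex_derive_continuousR; eexists; now apply is_derive_approx. }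
  assert (Huv : continuous (fun t => approx t + v t) s)
    by now apply (continuous_plus (V := R_NormedModule)).
  assert (Hddu : continuous ddapprox s).
  { unfold ddapprox, dph, ph.
    apply ex_derive_continuousR; auto_derive; repeat split; try lra; nra. }
  apply (continuous_opp (V := R_NormedModule)).
  apply (continuous_plus (V := R_NormedModule));
    [apply (continuous_plus (V := R_NormedModule))
    | now apply (continuous_plus (V := R_NormedModule))].
  - apply (continuous_mult (K := R_AbsRing)).
    + apply ex_derive_continuousR; auto_derive; lra.
    + apply (continuous_comp (fun t => approx t + v t) (fun y => y ^ 3)); trivial.
      apply ex_derive_continuousR; auto_derive; trivial.
  - apply (continuous_mult (K := R_AbsRing)); trivial.
    apply ex_derive_continuousR; auto_derive; nra.
Qed.

Hypothesis Hd : 0 <= d <= 1 / 1000.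

Let inv_bounds (s : R) : 1 <= s -> 0 < / s <= 1.
Proof.
  intros Hs; split; [apply Rinv_0_lt_compat; lra |].
  rewrite <- Rinv_1; apply Rinv_le_contravar; lra.
Qed.

(** Interval arithmetic for absolute values: the bound is an existential variable,
    filled in by the triangle inequality on the structure of the expression. *)
Ltac abs_bound :=
  match goal with
  | |- Rabs (_ + _) <= _ => apply Rabs_plus_bound; abs_bound
  | |- Rabs (_ - _) <= _ => apply Rabs_minus_bound; abs_bound
  | |- Rabs (- _) <= _ => rewrite Rabs_Ropp; abs_bound
  | |- Rabs (_ * _) <= _ => apply Rabs_mult_bound; abs_bound
  | |- Rabs (cos _) <= _ => apply Rabs_cos_le1
  | |- Rabs (sin _) <= _ => apply Rabs_sin_le1
  | |- Rabs _ <= _ => eassumption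
  | |- Rabs _ <= _ => rewrite Rabs_pos_eq by lra; apply Rle_refl
  end.

Ltac abs_bound_num :=
  eapply Rle_trans; [abs_bound | lra].

Lemma approx_bound (s : R) : 1 <= s -> Rabs (approx s) <= 11 / 10.
Proof.
  intros Hs; destruct (inv_bounds s Hs) as [p0 p1].
  assert (Hp : Rabs (/ s) <= 1) by (rewrite Rabs_pos_eq; lra).
  assert (Hd' : Rabs d <= 1 / 1000) by (rewrite Rabs_pos_eq; lra).
  unfold approx, Rdiv; abs_bound_num.
Qed.

(** All terms of order [1 / s] cancel: those in [cos (ph s)] by the choice of the
    phase, those in [cos (3 * ph s)] by the corrector. *)
Lemma residual_bound (s : R) : 1 <= s -> Rabs (remainder s 0) <= 3 / 10 / s ^ 2.
Proof.
  intros Hs; destruct (inv_bounds s Hs) as [p0 p1].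
  assert (Hp : Rabs (/ s) <= 1) by (rewrite Rabs_pos_eq; lra).
  assert (Hd' : Rabs d <= 1 / 1000) by (rewrite Rabs_pos_eq; lra).
  assert (Hu := approx_bound s Hs).
  set (p := / s) in *; set (k := cos (3 * ph s)); set (c := cos (ph s)).
  assert (Hk : k = 4 * c * c * c - 3 * c) by apply cos_triple.
  assert (Habs : Rabs k <= 1) by apply Rabs_cos_le1.
  assert (Habs' : Rabs c <= 1) by apply Rabs_cos_le1.
  (* [r] is the residual divided by [p ^ 2]: the terms before the product with
     [8 / 3 * d * (d / 12)] come from [ddapprox + approx], that product from the cube
     beyond its leading term [c ^ 3], and [approx s / 4] from the potential term *)
  set (r := - d * d * c + d * sin (ph s)
            + d / 12 * (2 * k * p + (6 + 9 * d * p) * sin (3 * ph s)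
                        - 9 * d * (2 + d * p) * k)
            + 8 / 3 * d * (d / 12) * k
              * (3 * c * c + 3 * c * (d / 12) * p * k + (d / 12) * (d / 12) * p * p * k * k)
            + approx s / 4).
  replace (remainder s 0) with (p ^ 2 * - r).
  - replace (3 / 10 / s ^ 2) with (p ^ 2 * (3 / 10)) by (unfold p; field; lra).
    rewrite Rabs_mult, (Rabs_pos_eq (p ^ 2)) by (apply pow_le; lra).
    apply Rmult_le_compat_l; [apply pow_le; lra |].
    unfold r, Rdiv; abs_bound_num.
  - assert (Ha : approx s = c + d / 12 * (k * p)) by reflexivity.
    unfold remainder, r, ddapprox, dph; fold k c; rewrite Rplus_0_r, Ha.
    transitivity (- (8 / 3 * d * p * (c + d / 12 * (k * p)) ^ 3
      + (c + d / 12 * (k * p)) / 4 * p ^ 2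
      + (- (1 + d * p) ^ 2 * c + d * p ^ 2 * sin (ph s)
         + d / 12 * (2 * k * p ^ 3 + (6 * p ^ 2 + 9 * d * p ^ 3) * sin (3 * ph s)
                     - 9 * (1 + d * p) ^ 2 * k * p)
         + (c + d / 12 * (k * p))))).
    (* the cancellation at order [p] rests on the triple angle formula [Hk] *)
    + rewrite Hk; field.
    + unfold p; field; lra.
Qed.

(** Both arguments [approx + w] are at most [11/10 + 2] in absolute value, so the
    cubic term contributes at most [8/3 * d * 3 * (31/10)^2 < 1/12]; the potential
    term contributes [1/4]. *)
Lemma remainder_lipschitz (s w w' : R) :
  1 <= s -> Rabs w <= 2 / s -> Rabs w' <= 2 / s ->
  Rabs (remainder s w - remainder s w') <= 1 / 3 / s * Rabs (w - w').
Proof.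
  intros Hs Hw Hw'; destruct (inv_bounds s Hs) as [p0 p1].
  assert (Hp : Rabs (/ s) <= 1) by (rewrite Rabs_pos_eq; lra).
  assert (Hd' : Rabs d <= 1 / 1000) by (rewrite Rabs_pos_eq; lra).
  assert (Hu := approx_bound s Hs).
  assert (HX : Rabs (approx s + w) <= 31 / 10).
  { unfold Rdiv in Hw; apply Rle_trans with (11 / 10 + 2); [| lra].
    apply Rabs_plus_bound; lra. }
  assert (HX' : Rabs (approx s + w') <= 31 / 10).
  { unfold Rdiv in Hw'; apply Rle_trans with (11 / 10 + 2); [| lra].
    apply Rabs_plus_bound; lra. }
  set (X := approx s + w) in *; set (X' := approx s + w') in *.
  replace (remainder s w - remainder s w')
    with (/ s * (- (8 / 3 * d * (X * X + X * X' + X' * X') + / s / 4)) * (w - w')).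
  - replace (1 / 3 / s) with (/ s * (1 / 3)) by (field; lra).
    rewrite !Rabs_mult, (Rabs_pos_eq (/ s)) by lra.
    apply Rmult_le_compat_r; [apply Rabs_pos |].
    apply Rmult_le_compat_l; [lra |].
    unfold Rdiv; abs_bound_num.
  - unfold remainder; fold X X'.
    replace (w - w') with (X - X') by (unfold X, X'; ring).
    field; lra.
Qed.

(** The radius [r = 2] closes the fixed-point argument with [K0 = 3/10] and
    [L = 1/3], as [2 * (3/10 + 2/3) <= 2]. *)
Lemma normalized_solution : exists h dh : R -> R,
  forall s, 1 <= s ->
    is_derive h s (dh s) /\
    is_derive dh s (- (1 + 8 / 3 * d / s * h s ^ 2 + 1 / (4 * s ^ 2)) * h s) /\
    Rabs (dh s - - dph s * sin (ph s)) + Rabs (h s - cos (ph s)) <= 5 / s.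
Proof.
  destruct (perturbed_oscillator remainder (3 / 10) (1 / 3) 2) as [w [dw Hw]];
    try lra.
  - apply continuous_remainder.
  - apply residual_bound.
  - apply remainder_lipschitz.
  - exists (fun s => approx s + w s), (fun s => dapprox s + dw s).
    intros s Hs; destruct (Hw s Hs) as [Dw [Ddw [Bw Bdw]]].
    destruct (inv_bounds s Hs) as [p0 p1].
    assert (Hp : Rabs (/ s) <= 1) by (rewrite Rabs_pos_eq; lra).
    assert (Hd' : Rabs d <= 1 / 1000) by (rewrite Rabs_pos_eq; lra).
    split; [| split].
    + apply (is_derive_plus (V := R_NormedModule)); trivial.
      now apply is_derive_approx.
    + replace (- (1 + 8 / 3 * d / s * (approx s + w s) ^ 2 + 1 / (4 * s ^ 2))
                 * (approx s + w s))
        with (ddapprox s + (remainder s (w s) - w s)) by (unfold remainder; field; lra).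
      apply (is_derive_plus (V := R_NormedModule)); trivial.
      now apply is_derive_dapprox.
    + replace (dapprox s + dw s - - dph s * sin (ph s))
        with (/ s * (d / 12 * (- (cos (3 * ph s) * / s)
                               - 3 * (1 + d * / s) * sin (3 * ph s))) + dw s)
        by (unfold dapprox, dph; field; lra).
      replace (approx s + w s - cos (ph s))
        with (/ s * (d / 12 * cos (3 * ph s)) + w s) by (unfold approx; field; lra).
      replace (5 / s) with ((/ s * (1 / 2) + 2 / s) + (/ s * (1 / 2) + 2 / s))
        by (field; lra).
      apply Rplus_le_compat; apply Rabs_plus_bound; trivial;
        rewrite Rabs_mult, (Rabs_pos_eq (/ s)) by lra;
        (apply Rmult_le_compat_l; [lra |]); unfold Rdiv; abs_bound_num.
Qed.

End Approximation.

(** * Rescaling *)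

Lemma deriv_on_ray_of_is_derive (f df : R -> R) :
  (forall s, 1 <= s -> is_derive f s (df s)) -> deriv_on_ray f df.
Proof.
  intros H s Hs.
  apply D_in_imp with no_cond; [now intros; split |].
  apply derivable_pt_lim_D_in, is_derive_Reals, H, Hs.
Qed.

Theorem proposition1p5 :
  exists delta0 C : R, 0 < delta0 /\
    forall beta a b : R, 0 <= delta beta a <= delta0 ->
      exists g dg : R -> R,
        ode_solution beta g dg /\
        forall rho : R, 1 <= rho ->
          Rabs (dg rho - Derive (g0 beta a b) rho)
          + Rabs (g rho - g0 beta a b rho) <= C * (Rabs a / rho).
Proof.
  exists (1 / 1000), 5; split; [lra |]; intros beta a b Hd.
  destruct (normalized_solution (delta beta a) b Hd) as [h [dh Hh]].
  exists (fun s => a * h s), (fun s => a * dh s); split.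
  - split.
    + apply deriv_on_ray_of_is_derive; intros s Hs.
      apply is_derive_scal, Hh, Hs.
    + exists (fun s => a * (- (1 + 8 / 3 * delta beta a / s * h s ^ 2 + 1 / (4 * s ^ 2))
                              * h s)); split.
      * apply deriv_on_ray_of_is_derive; intros s Hs.
        apply is_derive_scal, Hh, Hs.
      * intros s Hs; unfold delta; field; lra.
  - intros s Hs; destruct (Hh s Hs) as [_ [_ Hbound]].
    replace (Derive (g0 beta a b) s)
      with (a * (- dph (delta beta a) s * sin (ph (delta beta a) b s))).
    + unfold g0; change (phase beta a b s) with (ph (delta beta a) b s).
      rewrite <- !Rmult_minus_distr_l, !Rabs_mult, <- Rmult_plus_distr_l.
      replace (5 * (Rabs a / s)) with (Rabs a * (5 / s)) by (field; lra).
      apply Rmult_le_compat_l; [apply Rabs_pos | exact Hbound].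
    + symmetry; apply is_derive_unique.
      unfold g0, phase, dph, ph; auto_derive; [lra | field; lra].
Qed.
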